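(* For every odd integer $n \ge 7$, the domination number of the Johnson graph $J(n,3)$ satisfies $$\gamma(J(n,3)) \;=\; \phi_n .$$
   Context: All graphs are finite, undirected, simple and loopless. The Johnson graph $J(n,k)$ has vertex set $\binom{[n]}{k}$ (the $k$-element subsets of $[n]=\{1,\dots,n\}$), two vertices being adjacent if and only if their intersection has size exactly $k-1$. A dominating set of a graph $G$ is a set $D \subseteq V(G)$ such that every vertex of $G$ lies in $D$ or has a neighbour in $D$; the domination number $\gamma(G)$ is the minimum size of a dominating set. For a graph $G$, an edge-covering by triangles is a set $T$ of triangles of $G$ such that every edge of $G$ lies in some triangle of $T$; $\rho_\Delta(G)$ denotes the minimum size of such a $T$ (and $\rho_\Delta(G)=\infty$ if none exists). For $m\ge 3$ put $|C_m| := \rho_\Delta(K_m)$. By a theorem of Fort and Hedlund, $|C_m| = m^2/6$ if $m\equiv 0 \pmod 6$; $m(m-1)/6$ if $m\equiv 1,3 \pmod 6$; $(m^2+2)/6$ if $m\equiv 2,4\pmod 6$; $(m^2-m+4)/6$ if $m\equiv 5\pmod 6$. For $n \ge 6$ define $$\phi_n := \min\{ |C_{m_1}| + |C_{m_2}| : m_1+m_2=n,\ m_1,m_2\ge 3\}.$$ For odd $n\ge 7$ this has the closed form $\phi_n = (n^2-n+b_n)/12$, where $b_n = 0$ if $n\equiv 1$, $b_n=4$ if $n\equiv 5$, $b_n=6$ if $n\equiv 3,7$, $b_n=10$ if $n\equiv 11$, and $b_n=12$ if $n\equiv 9 \pmod{12}$. *)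

(* Defs.v *)
From mathcomp Require Import all_boot.

Set Implicit Arguments.
Unset Strict Implicit.
Unset Printing Implicit Defensive.

(* Finite simple graphs. *)
Record sgraph := SGraph {
  vertex :> finType;
  adj : rel vertex;
  adj_sym : symmetric adj;
  adj_irrefl : irreflexive adj }.

Definition dominating (G : sgraph) (D : {set G}) : bool :=
  [forall v : G, (v \in D) || [exists u in D, adj v u]].

Lemma dominating_setT (G : sgraph) : dominating [set: G].
Proof. by apply/forallP => v; rewrite inE. Qed.

Definition domination_number (G : sgraph) : nat :=
  #|[arg min_(D < [set: G] | dominating D) #|D| ]|.

Lemma domination_number_min (G : sgraph) :
  (exists2 D : {set G}, dominating D & #|D| = domination_number G) /\
  (forall D : {set G}, dominating D -> domination_number G <= #|D|).
Proof.
rewrite /domination_number; case: arg_minnP; first exact: dominating_setT.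
by move=> D domD minD; split => //; exists D.
Qed.

Definition triangles (G : sgraph) : {set {set G}} :=
  [set t : {set G} | (#|t| == 3)
     && [forall x in t, forall y in t, (x != y) ==> adj x y]].

Definition triangle_cover (G : sgraph) (T : {set {set G}}) : bool :=
  (T \subset triangles G) &&
  [forall x : G, forall y : G, adj x y ==>
     [exists t in T, (x \in t) && (y \in t)]].

(* Minimum size of an edge-covering by triangles; [None] stands for infinity.
   A covering exists iff the set of all triangles is one
   (see [triangle_cover_numberP]). *)
Definition triangle_cover_number (G : sgraph) : option nat :=
  if triangle_cover (triangles G) then
    Some #|[arg min_(T < triangles G | triangle_cover T) #|T| ]|
  else None.

Lemma triangle_cover_numberP (G : sgraph) :
  match triangle_cover_number G with
  | Some r => (exists2 T : {set {set G}}, triangle_cover T & #|T| = r) /\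
              (forall T : {set {set G}}, triangle_cover T -> r <= #|T|)
  | None => forall T : {set {set G}}, ~~ triangle_cover T
  end.
Proof.
rewrite /triangle_cover_number; case: ifPn => [cT | ncT].
  by case: arg_minnP => // T covT minT; split => //; exists T.
move=> T; apply: contra ncT => /andP[sT /forallP covT].
rewrite /triangle_cover subxx; apply/forallP => x; apply/forallP => y.
apply/implyP => xy; have /forallP/(_ y)/implyP/(_ xy) := covT x.
case/existsP => t /andP[tT xyt]; apply/existsP; exists t.
by rewrite (subsetP sT).
Qed.

Section Johnson.
Variables n k : nat.

Definition johnson_vertex := {A : {set 'I_n} | #|A| == k}.

(* The successor, rather than [k.-1], keeps the relation loopless at k = 0. *)
Definition johnson_adj : rel johnson_vertex :=
  fun A B => #|val A :&: val B|.+1 == k.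

Lemma johnson_adj_sym : symmetric johnson_adj.
Proof. by move=> A B; rewrite /johnson_adj setIC. Qed.

Lemma johnson_adj_irrefl : irreflexive johnson_adj.
Proof.
by move=> A; rewrite /johnson_adj setIid (eqP (valP A)) gtn_eqF.
Qed.

Definition johnson : sgraph := SGraph johnson_adj_sym johnson_adj_irrefl.

End Johnson.

Section Complete.
Variable m : nat.

Definition complete_adj : rel 'I_m := fun x y => x != y.

Lemma complete_adj_sym : symmetric complete_adj.
Proof. by move=> x y; rewrite /complete_adj eq_sym. Qed.

Lemma complete_adj_irrefl : irreflexive complete_adj.
Proof. by move=> x; rewrite /complete_adj eqxx. Qed.

Definition complete : sgraph := SGraph complete_adj_sym complete_adj_irrefl.

End Complete.

Lemma complete_triangle_cover m :
  3 <= m -> triangle_cover (triangles (complete m)).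
Proof.
move=> m3; rewrite /triangle_cover subxx.
apply/forallP => x; apply/forallP => y; apply/implyP => xy.
have /card_gt0P[z] : 0 < #|~: [set x; y] : {set 'I_m}|.
  rewrite cardsCs setCK card_ord cards2 subn_gt0.
  by case: (x != y); [|exact: ltnW].
rewrite !inE negb_or => /andP[zx zy].
apply/existsP; exists (z |: [set x; y]).
rewrite !inE !eqxx !orbT !andbT cardsU1 cards2 !inE negb_or zx zy.
rewrite (xy : x != y) /=; apply/forallP => u; apply/implyP => _.
by apply/forallP => v; apply/implyP => _; apply/implyP.
Qed.

(* |C_m|, meaningful for m >= 3; the default value is not reached there. *)
Definition C_card (m : nat) : nat :=
  odflt 0 (triangle_cover_number (complete m)).

Lemma C_cardE m : 3 <= m -> triangle_cover_number (complete m) = Some (C_card m).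
Proof.
by move=> m3; rewrite /C_card /triangle_cover_number complete_triangle_cover.
Qed.

Definition phi_dom n (m : 'I_n.+1 * 'I_n.+1) : bool :=
  [&& m.1 + m.2 == n, 3 <= m.1 & 3 <= m.2].

Definition phi_val n (m : 'I_n.+1 * 'I_n.+1) : nat :=
  C_card m.1 + C_card m.2.

(* The initial candidate is admissible exactly when n >= 6. *)
Definition phi (n : nat) : nat :=
  let m0 : 'I_n.+1 * 'I_n.+1 := (inord 3, inord (n - 3)) in
  phi_val [arg min_(m < m0 | phi_dom m) phi_val m].

Lemma phi_min n : 6 <= n ->
  (exists m1 m2, [/\ m1 + m2 = n, 3 <= m1, 3 <= m2
                   & C_card m1 + C_card m2 = phi n]) /\
  (forall m1 m2, m1 + m2 = n -> 3 <= m1 -> 3 <= m2 ->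
     phi n <= C_card m1 + C_card m2).
Proof.
move=> n6; rewrite /phi; case: arg_minnP.
  have n3 : 3 <= n by apply: leq_trans n6.
  rewrite /phi_dom /= !inordK ?ltnS ?leq_subr // subnKC // eqxx /=.
  by rewrite leq_subRL.
move=> m /and3P[/eqP ms m1 m2] minm; split.
  by exists m.1, m.2.
move=> a b abn a3 b3.
have an : a < n.+1 by rewrite ltnS -abn leq_addr.
have bn : b < n.+1 by rewrite ltnS -abn leq_addl.
by apply: (minm (Ordinal an, Ordinal bn)); rewrite /phi_dom /= abn eqxx a3 b3.
Qed.

(* Main.v *)
Require Import Defs.
From mathcomp Require Import all_boot.
From mathcomp Require Import zify.

Set Implicit Arguments.
Unset Strict Implicit.
Unset Printing Implicit Defensive.

(* A triple is dominated by a family D of triples iff one of its pairs lies in a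
   block of D, so D is dominating iff the graph G of the pairs covered by no block
   is triangle-free.  Splitting the points into two parts and covering the pairs
   inside each part gives the upper bound.

   For the lower bound let n = 2m+1 and let e(v) be the degree in G.  A point v
   lies in at least m - floor(e(v)/2) blocks, whence
   3 |D| >= nm - sum floor(e(v)/2).  With f(v) = 2 floor(e(v)/2), an edge uv of the
   triangle-free graph G has f(u) + f(v) <= n, hence <= 2m as both are even;
   so sum e f <= m sum e, and sum (e-m)(f-m) >= 0 gives sum f <= nm, that is
   6 |D| >= nm.  When m = 4 mod 6 equality would force G = K_{m,m+1} and a Steiner
   triple system on m+1 = 5 mod 6 points, which does not exist.

   Rounded up, these bounds are attained by coverings of K_k on 'I_N x Z_3 (plus at most two
   further points): the Bose and Skolem triple systems for k = 3, 1 mod 6, a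
   variant over Z_{2t} for k = 0, and one point added to a triple system for
   k = 2, 4. *)

(** The two sides differ by (e-m)(f-m), which is nonnegative because no integer lies strictly
    between f and e. *)
Lemma leqif_dev m e f : f <= e <= f.+1 ->
  m * e + m * f <= e * f + m * m ?= iff (e == m) || (f == m).
Proof.
case/andP => fe ef; have [em|em|->] := ltngtP e m.
- have -> : f == m = false by apply/eqP; lia.
  by split; [nia | apply/negbTE/eqP; nia].
- have [fm|->] : f > m \/ f = m by lia.
    by rewrite gtn_eqF //; split; [nia | apply/negbTE/eqP; nia].
  by rewrite eqxx; split; [lia | rewrite [m * e]mulnC eqxx].
- by split; [lia | rewrite addnC eqxx].
Qed.

(** * Triangle-free graphs of odd order *)

Section TriangleFree.
Variables (V : finType) (g : rel V).
Hypotheses (g_sym : symmetric g)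
  (g_tf : forall x y z, g x y -> g x z -> g y z = false).

Definition nbr (v : V) : {set V} := [set w | g v w].

Lemma nbr_disjoint u v : g u v -> [disjoint nbr u & nbr v].
Proof.
move=> uv; apply/pred0P => w /=; rewrite !inE.
by apply/negP => /andP[uw]; rewrite (g_tf uv uw).
Qed.

Lemma card_nbr_edge u v : g u v -> #|nbr u| + #|nbr v| <= #|V|.
Proof.
move=> /nbr_disjoint; rewrite -(leq_card_setU (nbr u) (nbr v)) => /eqP <-.
exact: max_card.
Qed.

(** Summing f(u) + f(v) over the ordered adjacent pairs counts each f(v) twice for every neighbour
    of v. *)
Lemma sum_nbr_edge (m : nat) (f : V -> nat) :
  (forall u v, g u v -> f u + f v <= m.*2) ->
  \sum_v #|nbr v| * f v <= m * \sum_v #|nbr v|.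
Proof.
move=> fm.
have degE (h : V -> nat) :
    \sum_v #|nbr v| * h v = \sum_v \sum_(w | g v w) h v.
  apply: eq_bigr => v _; rewrite sum_nat_const; congr (_ * _).
  by apply: eq_card => w; rewrite !inE.
have swap : \sum_v \sum_(w | g v w) f v = \sum_v \sum_(w | g v w) f w.
  rewrite (exchange_big_dep xpredT) //=; apply: eq_bigr => w _.
  by apply: eq_bigl => v; rewrite g_sym.
have : \sum_v \sum_(w | g v w) (f v + f w) <= \sum_v #|nbr v| * m.*2.
  rewrite (degE (fun=> m.*2)); apply: leq_sum => v _; apply: leq_sum => w.
  exact: fm.
under eq_bigr do rewrite big_split.
rewrite big_split /= -swap -degE -big_distrl /=.
by nia.
Qed.

Variable m : nat.
Hypothesis cardV : #|V| = m.*2.+1.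

Lemma sum_half_degree_le_eq : 0 < m ->
  (\sum_v #|nbr v|./2).*2 <= #|V| * m /\
  ((\sum_v #|nbr v|./2).*2 = #|V| * m ->
   forall v, (#|nbr v| == m) || (#|nbr v|./2.*2 == m)).
Proof.
(* Sum (e - m) (f - m) >= 0, where e is the degree and f the largest even
   number below it, against the bound f u + f v <= 2 m on the edges. *)
move=> m_gt0; pose e v := #|nbr v|; pose f v := (e v)./2.*2.
have edge u v : g u v -> f u + f v <= m.*2.
  by move=> /card_nbr_edge; rewrite cardV /f /e; lia.
have dev v : m * e v + m * f v <= e v * f v + m * m
    ?= iff (e v == m) || (f v == m).
  by apply: leqif_dev; rewrite /f; lia.
have [sum_dev eq_dev] := leqif_sum (fun v (_ : xpredT v) => dev v).
move: sum_dev eq_dev; rewrite !big_split /= -!big_distrr /= sum_nat_const.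
rewrite -[#|xpredT|]/#|V|; have -> : \sum_v f v = (\sum_v #|nbr v|./2).*2.
  by rewrite -mul2n big_distrr; apply: eq_bigr => w _; rewrite /f -mul2n.
have := sum_nbr_edge edge; rewrite -/e.
set EF := \sum_v e v * f v; set E := \sum_v e v; set F := _.*2.
move=> le1 le2 eq_dev; split; first by rewrite -(leq_pmul2l m_gt0); nia.
move=> eqF v; have : [forall (v | true), (e v == m) || (f v == m)].
  by rewrite -eq_dev eqn_leq le2 eqF; nia.
by move=> /forallP/(_ v).
Qed.

Lemma sum_half_degree : 0 < m -> (\sum_v #|nbr v|./2).*2 <= #|V| * m.
Proof. by move=> /sum_half_degree_le_eq[]. Qed.

Lemma sum_half_degree_eq : 0 < m -> ~~ odd m ->
  (\sum_v #|nbr v|./2).*2 = #|V| * m ->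
  forall v, #|nbr v| = m \/ #|nbr v| = m.+1.
Proof.
by move=> /sum_half_degree_le_eq[_ eqP] m_even /eqP/[swap] v /(_ v); lia.
Qed.

(** Otherwise the graph is m-regular. The neighbourhoods of the ends of an edge then miss a single
    vertex w, and w has at most one neighbour in each of them, so that m <= 2. *)
Lemma almost_regular_max_degree : 2 < m ->
  (forall v, #|nbr v| = m \/ #|nbr v| = m.+1) -> exists v, #|nbr v| = m.+1.
Proof.
move=> m_gt2 deg; apply/exists_eqP; apply: contraT => /existsPn ndeg.
have {deg ndeg} reg v : #|nbr v| = m.
  by case: (deg v) => // dv; have := ndeg v; rewrite dv eqxx.
have g_irr x : g x x = false by apply/negP => xx; have := g_tf xx xx; rewrite xx.
have [u _] : exists u : V, u \in V by apply/card_gt0P; rewrite cardV.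
have [v] : exists v, v \in nbr u by apply/card_gt0P; rewrite reg; lia.
rewrite inE => uv.
have [w wP] : exists w, nbr u :|: nbr v = [set~ w].
  have : #|~: (nbr u :|: nbr v)| == 1.
    have := nbr_disjoint uv; rewrite -(leq_card_setU (nbr u) (nbr v)) !reg.
    by move=> /eqP c; have := cardsC (nbr u :|: nbr v); rewrite c cardV; lia.
  by case/cards1P => w wE; exists w; rewrite -wE setCK.
(* A neighbour of [w] in [nbr p] has only one non-neighbour in [nbr q]. *)
have side p q : g p q -> nbr p :|: nbr q = [set~ w] ->
    #|nbr w :&: nbr q| <= 1.
  move=> pq pqw.
  have cover_pq y : g p y || g q y = (y != w).
    by have /setP/(_ y) := pqw; rewrite !inE.
  (* If [w] had no neighbour in [nbr p], then [nbr w] would equal [nbr q], which contains [p]. *)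
  have [x wx px] : exists2 x, g w x & g p x.
    apply/exists_inP; apply: contraT => /exists_inPn npw.
    have /eqP Ew : nbr w == nbr q.
      rewrite eqEcard !reg leqnn andbT; apply/subsetP => y; rewrite !inE => wy.
      have := cover_pq y; rewrite (negbTE (npw y wy)) /= => ->.
      by apply: contraTneq wy => ->; rewrite g_irr.
    have : p \in nbr w by rewrite Ew inE g_sym.
    by rewrite inE g_sym => pw; have := cover_pq w; rewrite pw eqxx.
  have sub : nbr x \subset w |: (nbr q :\: nbr w).
    apply/subsetP => y; rewrite !inE => xy.
    have [//|yw /=] := eqVneq y w.
    have := cover_pq y; rewrite yw => /orP[py|->].
      by have := g_tf px py; rewrite xy.
    by rewrite andbT; apply/negP => wy; have := g_tf wx wy; rewrite xy.
  have := subset_leq_card sub; rewrite reg cardsU1.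
  have := cardsID (nbr w) (nbr q); rewrite reg setIC.
  by case: (_ \notin _) => /=; lia.
have : #|nbr w| <= #|nbr w :&: nbr u| + #|nbr w :&: nbr v|.
  rewrite -[nbr w in X in X <= _](setIidPl (_ : _ \subset [set~ w])).
    by rewrite -wP setIUr; apply: leq_card_setU.
  by apply/subsetP => y; rewrite !inE; apply: contraTneq => ->; rewrite g_irr.
have := side u v uv wP; have := side v u; rewrite g_sym setUC => /(_ uv wP).
by rewrite reg; lia.
Qed.

(** A neighbour of v is adjacent to nothing in [nbr v], hence by the degree bound to all m points
    outside. Points outside [nbr v] share a neighbour in it, so they are not adjacent. *)
Lemma max_degree_bipartite v : #|nbr v| = m.+1 ->
  (forall w, m <= #|nbr w|) ->
  forall x y, g x y = (x \in nbr v) (+) (y \in nbr v).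
Proof.
move=> dv deg.
have Enbr x : x \in nbr v -> nbr x = ~: nbr v.
  move=> vx; apply/eqP; rewrite eqEcard; apply/andP; split.
    apply/subsetP => y; rewrite !inE => xy; apply/negP => vy.
    by move: vx; rewrite inE => vx; have := g_tf vx vy; rewrite xy.
  by apply: leq_trans (deg x); have := cardsC (nbr v); rewrite dv cardV; lia.
have [x0 vx0] : exists x, x \in nbr v by apply/card_gt0P; rewrite dv.
have gE x y : x \in nbr v -> g x y = (y \notin nbr v).
  by move=> vx; have /setP/(_ y) := Enbr x vx; rewrite !inE.
move=> x y; case: (boolP (x \in nbr v)) => vx; first by rewrite gE.
case: (boolP (y \in nbr v)) => vy; first by rewrite g_sym gE // vx.
by apply: (g_tf (x := x0)); rewrite gE.
Qed.

End TriangleFree.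

(** * Pairs left uncovered by a triple system *)

Section TripleSystem.
Variables (V : finType) (B : {set {set V}}).
Hypothesis B3 : forall b, b \in B -> #|b| = 3.

Definition uncovered : rel V :=
  fun x y => (x != y) && ~~ [exists b in B, (x \in b) && (y \in b)].

Lemma uncovered_sym : symmetric uncovered.
Proof.
move=> x y; rewrite /uncovered eq_sym; congr (_ && ~~ _).
by apply: eq_existsb => b; rewrite [(x \in b) && _]andbC.
Qed.

Lemma uncovered_block b x y :
  b \in B -> x \in b -> y \in b -> uncovered x y = false.
Proof.
move=> bB xb yb; apply/negbTE; rewrite negb_and !negbK orbC.
by apply/orP; left; apply/existsP; exists b; rewrite bB xb.
Qed.

Definition replication v := #|[set b in B | v \in b]|.

Lemma sum_replication (A : {set V}) :
  \sum_(v in A) replication v = \sum_(b in B) #|A :&: b|.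
Proof.
under eq_bigr => v _ do rewrite /replication -sum1_card.
rewrite (exchange_big_dep (mem B)) /=; last first.
  by move=> v b _; rewrite inE => /andP[].
apply: eq_bigr => b bB; rewrite -sum1_card; apply: eq_bigl => v.
by rewrite !inE bB.
Qed.

(** Each block through v accounts for two points other than v; the points left over are uncovered
    neighbours. *)
Lemma card_pred_uncovered v :
  #|V|.-1 <= #|nbr uncovered v| + (replication v).*2.
Proof.
pose P := [set b :\ v | b in [set b in B | v \in b]].
have le : #|cover P| <= (replication v).*2.
  apply: leq_trans (leq_card_cover _) _.
  apply: (@leq_trans (\sum_(A in P) 2)).
    apply: leq_sum => A /imsetP[b + ->]; rewrite inE => /andP[bB vb].
    by have := cardsD1 v b; rewrite vb B3 //; lia.
  by rewrite sum_nat_const muln2 leq_double leq_imset_card.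
rewrite -(cardsC1 v); apply: leq_trans (leq_add (leqnn _) le).
apply: leq_trans (leq_card_setU _ _); apply/subset_leq_card/subsetP => w.
rewrite !inE => wv; rewrite /uncovered eq_sym wv /=.
case: existsP => //= -[b /and3P[bB vb wb]].
by apply/bigcupP; exists (b :\ v); rewrite ?inE ?wv //; apply/imsetP;
  exists b; rewrite // inE bB.
Qed.

Hypothesis uncovered_tf : forall x y z,
  uncovered x y -> uncovered x z -> uncovered y z = false.

Variable m : nat.
Hypotheses (cardV : #|V| = m.*2.+1) (m_gt2 : 2 < m).

Lemma leq_replication v : m <= replication v + #|nbr uncovered v|./2.
Proof. by have := card_pred_uncovered v; rewrite cardV /=; lia. Qed.

Lemma sum_replicationT : \sum_v replication v = 3 * #|B|.
Proof.
have := sum_replication setT; under eq_bigl do rewrite inE.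
move=> ->; rewrite mulnC -sum_nat_const; apply: eq_bigr => b bB.
by rewrite setTI B3.
Qed.

Lemma leq_replication_sum : #|V| * m <= 3 * #|B| + \sum_v #|nbr uncovered v|./2.
Proof.
rewrite -sum_replicationT -big_split /= -sum_nat_const.
by apply: leq_sum => v _; apply: leq_replication.
Qed.

Lemma triple_system_lower : #|V| * m <= 6 * #|B|.
Proof.
have m_gt0 : 0 < m by apply: leq_trans m_gt2.
have := sum_half_degree uncovered_sym uncovered_tf cardV m_gt0.
by have := leq_replication_sum; lia.
Qed.

(* In the equality case the uncovered pairs form K_{m,m+1} and every point of
   the larger part has replication number m/2; the blocks meeting that part lie
   inside it, so that their number is m(m+1)/6. *)
Lemma triple_system_lower_strict :
  m %% 6 = 4 -> #|V| * m < 6 * #|B|.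
Proof.
move=> m4; rewrite ltn_neqAle triple_system_lower andbT; apply/eqP => eqB.
have m_gt0 : 0 < m by apply: leq_trans m_gt2.
have le1 := sum_half_degree uncovered_sym uncovered_tf cardV m_gt0.
have le2 := leq_replication_sum.
have eqS : (\sum_v #|nbr uncovered v|./2).*2 = #|V| * m.
  apply/eqP; rewrite eqn_leq le1 /=; move: le2; rewrite eqB.
  by set S := \sum_v _; clearbody S; clear; lia.
have m_even : ~~ odd m by lia.
have degP := sum_half_degree_eq uncovered_sym uncovered_tf cardV m_gt0 m_even eqS.
(* The bounds [leq_replication] sum to an equality, so each of them is one; the degrees m and m+1
   both halve to m/2. *)
have repl v : replication v = m./2.
  have [_] := leqif_sum (fun w (_ : xpredT w) => leqif_eq (leq_replication w)).
  rewrite big_split /= sum_replicationT sum_nat_const -[#|xpredT|]/#|V|.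
  have -> : #|V| * m == 3 * #|B| + \sum_v #|nbr uncovered v|./2.
    apply/eqP; rewrite -eqS; move: eqB; rewrite -eqS.
    by set S := \sum_v _; clearbody S; clear; lia.
  move=> /esym/forallP/(_ v)/eqP/=.
  by have := degP v; clear -m_even; lia.
have [v dv] := almost_regular_max_degree uncovered_sym uncovered_tf cardV m_gt2 degP.
have deg_ge w : m <= #|nbr uncovered w| by case: (degP w) => ->.
have gE := max_degree_bipartite uncovered_sym uncovered_tf cardV dv deg_ge.
set A := nbr uncovered v in dv gE.
have : 3 %| \sum_(x in A) replication x.
  rewrite sum_replication; apply: dvdn_sum => b bB.
  have [->|[x]] := set_0Vmem (A :&: b); first by rewrite cards0.
  rewrite inE => /andP[xA xb]; rewrite (setIidPr _) ?B3 //.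
  apply/subsetP => y yb; have := uncovered_block bB xb yb.
  by rewrite gE xA addTb => /negbFE.
under eq_bigr do rewrite repl.
rewrite sum_nat_const dv; move: m4; clear; move=> m4.
(* For m = 6k+4 the sum is (6k+5)(3k+2), which is 1 mod 3. *)
by have [k ->] : exists k, m = 6 * k + 4; [exists (m %/ 6)|]; lia.
Qed.

End TripleSystem.

(** * Domination in J(n,3) *)

Section Johnson3.
Variable n : nat.
Implicit Type D : {set johnson n 3}.

Lemma johnson3_dominatingP D :
  reflect (forall v : johnson n 3, exists2 A : johnson n 3,
             A \in D & 1 < #|val v :&: val A|)
          (dominating D).
Proof.
apply: (iffP forallP) => dom v.
  have /orP[vD|/existsP[A /andP[AD vA]]] := dom v.
    by exists v => //; rewrite setIid (eqP (valP v)).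
  by exists A => //; move: vA => /eqP[->].
have [A AD vA] := dom v; have v3 := eqP (valP v); have A3 := eqP (valP A).
have [vIA|vIA] : #|val v :&: val A| = 2 \/ 2 < #|val v :&: val A| by lia.
  by apply/orP; right; apply/existsP; exists A; rewrite AD /= /johnson_adj vIA.
have EI (X : {set 'I_n}) : #|X| = 3 -> val v :&: val A \subset X ->
    val v :&: val A = X.
  by move=> X3 sX; apply/eqP; rewrite eqEcard sX X3.
have -> : v = A.
  by apply: val_inj; rewrite -{1}(EI _ v3) ?subsetIl // -{2}(EI _ A3) ?subsetIr.
by rewrite AD.
Qed.

Definition blocks D : {set {set 'I_n}} := [set val A | A in D].

Lemma card_blocks D : #|blocks D| = #|D|.
Proof. exact/card_imset/val_inj. Qed.

Lemma blocks3 D b : b \in blocks D -> #|b| = 3.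
Proof. by case/imsetP => A _ ->; apply/eqP/(valP A). Qed.

(** A vertex that dominates {x,y,z} shares two points with it, and its block covers that pair. *)
Lemma dominating_uncovered D : dominating D ->
  forall x y z, uncovered (blocks D) x y -> uncovered (blocks D) x z ->
    uncovered (blocks D) y z = false.
Proof.
move=> /johnson3_dominatingP dom x y z xy xz; apply/negP => yz.
have xyz3 : #|[set x; y; z]| == 3.
  move: xy xz yz => /andP[xy _] /andP[xz _] /andP[yz _].
  by rewrite setUC cardsU1 cards2 xy !inE negb_or ![z == _]eq_sym xz yz.
have [A AD] := dom (Sub [set x; y; z] xyz3 : johnson_vertex n 3).
case/card_gt1P => a [b]; rewrite !inE /= => -[/andP[xa aA] /andP[xb bA] ab].
have AB : val A \in blocks D by apply: imset_f.
have := uncovered_block AB aA bA; have := uncovered_block AB bA aA.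
move: xa xb ab.
by do 2![case/orP => [/orP[]|] /eqP->]; rewrite ?eqxx ?xy ?xz ?yz.
Qed.

(** The boolean summand records the strict inequality for m = 4 mod 6. *)
Lemma johnson3_dominating_lower m D : n = m.*2.+1 -> 2 < m ->
  dominating D -> n * m + (m %% 6 == 4) <= 6 * #|D|.
Proof.
move=> nm m_gt2 /dominating_uncovered tf; rewrite -card_blocks.
have cardV : #|'I_n| = m.*2.+1 by rewrite card_ord.
have := triple_system_lower (@blocks3 D) tf cardV m_gt2.
have := triple_system_lower_strict (@blocks3 D) tf cardV m_gt2.
by rewrite card_ord; case: eqP => [m4 /(_ m4)|_ _]; rewrite ?addn1 ?addn0.
Qed.

End Johnson3.

(** * Triangle coverings and the upper bound on the domination number *)

Lemma C_card_min m (T : {set {set complete m}}) :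
  3 <= m -> triangle_cover T -> C_card m <= #|T|.
Proof.
move=> m3; have := triangle_cover_numberP (complete m).
by rewrite C_cardE // => -[_]; apply.
Qed.

Lemma C_card_cover m : 3 <= m ->
  exists2 T : {set {set complete m}}, triangle_cover T & #|T| = C_card m.
Proof.
move=> m3; have := triangle_cover_numberP (complete m).
by rewrite C_cardE // => -[].
Qed.

Lemma triangle_coverP m (T : {set {set complete m}}) x y :
  triangle_cover T -> x != y -> exists t, [/\ t \in T, x \in t & y \in t].
Proof.
case/andP => _ /forallP/(_ x)/forallP/(_ y)/implyP cov xy.
by have /existsP[t /and3P[]] := cov xy; exists t.
Qed.

Lemma triangle_cover_card3 (G : sgraph) (T : {set {set G}}) t :
  triangle_cover T -> t \in T -> #|t| = 3.
Proof.
by case/andP => /subsetP sT _ /sT; rewrite inE => /andP[/eqP].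
Qed.

Lemma leq_card_johnson3_blocks n k (f : 'I_k -> 'I_n)
    (T : {set {set 'I_k}}) :
  injective f -> (forall t, t \in T -> #|t| = 3) ->
  exists2 D : {set johnson n 3}, #|D| <= #|T|
    & forall t, t \in T -> exists2 A, A \in D & val A = f @: t.
Proof.
move=> f_inj T3; exists [set A | val A \in [set f @: (t : {set 'I_k}) | t in T]].
  rewrite -(card_imset _ val_inj); apply: leq_trans (leq_imset_card _ T).
  apply/subset_leq_card/subsetP => _ /imsetP[A + ->]; rewrite inE.
  exact.
move=> t tT; have ft3 : #|f @: t| == 3 by rewrite card_imset // T3.
by exists (Sub (f @: t) ft3 : johnson_vertex n 3) => //; rewrite inE /=; apply: imset_f.
Qed.

(** By the pigeonhole principle every triple has two points in one part; the triangle covering this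
    pair dominates it. *)
Lemma domination_johnson3_leq m1 m2 : 3 <= m1 -> 3 <= m2 ->
  domination_number (johnson (m1 + m2) 3) <= C_card m1 + C_card m2.
Proof.
move=> m13 m23; have [T1 cov1 <-] := C_card_cover m13.
have [T2 cov2 <-] := C_card_cover m23.
have [D1 leD1 D1P] := leq_card_johnson3_blocks (@lshift_inj m1 m2)
  (fun t => @triangle_cover_card3 _ T1 t cov1).
have [D2 leD2 D2P] := leq_card_johnson3_blocks (@rshift_inj m1 m2)
  (fun t => @triangle_cover_card3 _ T2 t cov2).
have [_ min] := domination_number_min (johnson (m1 + m2) 3).
apply: leq_trans (min (D1 :|: D2) _) _; last first.
  by apply: leq_trans (leq_card_setU _ _) (leq_add leD1 leD2).
have pair (A B : {set 'I_(m1 + m2)}) x y :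
    x != y -> x \in A :&: B -> y \in A :&: B -> 1 < #|A :&: B|.
  by move=> xy xAB yAB; apply/card_gt1P; exists x, y.
apply/johnson3_dominatingP => v.
have : 3 <= #|lshift m2 @^-1: val v| + #|@rshift m1 m2 @^-1: val v|.
  rewrite -{1}(eqP (valP v)) -(card_imset _ (@lshift_inj m1 m2)).
  rewrite -(card_imset (_ @^-1: _) (@rshift_inj m1 m2)).
  apply: leq_trans (leq_card_setU _ _); apply/subset_leq_card/subsetP => x.
  rewrite inE; case: (split_ordP x) => y -> vy.
    by rewrite imset_f ?inE.
  by rewrite orbC imset_f ?inE.
have [|] := ltnP 1 #|lshift m2 @^-1: val v|.
  case/card_gt1P => x [y [vx vy xy]] _.
  have [t [tT tx ty]] := triangle_coverP cov1 xy.
  have [A AD EA] := D1P t tT; exists A; first by rewrite inE AD.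
  apply: (@pair _ _ (lshift m2 x) (lshift m2 y));
    rewrite ?(inj_eq (@lshift_inj _ _)) // inE EA imset_f // andbT.
    by rewrite inE in vx.
  by rewrite inE in vy.
move=> le1 le3; have /card_gt1P[x [y [vx vy xy]]] :
    1 < #|@rshift m1 m2 @^-1: val v| by lia.
have [t [tT tx ty]] := triangle_coverP cov2 xy.
have [A AD EA] := D2P t tT; exists A; first by rewrite inE AD orbT.
apply: (@pair _ _ (rshift m1 x) (rshift m1 y));
  rewrite ?(inj_eq (@rshift_inj _ _)) // inE EA imset_f // andbT.
  by rewrite inE in vx.
by rewrite inE in vy.
Qed.

(** * Bounding [C_card] by explicit coverings *)

Lemma exists_superset3 (T : finType) (A : {set T}) :
  3 <= #|T| -> #|A| <= 3 -> exists2 t : {set T}, #|t| = 3 & A \subset t.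
Proof.
move=> T3; move Dk: (3 - #|A|) => k; elim: k A Dk => [|k IHk] A Dk A3.
  by exists A => //; lia.
have /card_gt0P[x] : 0 < #|~: A| by have := cardsC A; lia.
rewrite inE => xA; have cA : #|x |: A| = #|A|.+1 by rewrite cardsU1 xA.
have [||t t3 sAt] := IHk (x |: A); [lia|lia|].
by exists t => //; apply: subset_trans sAt; apply: subsetUr.
Qed.

(** Degenerate blocks are enlarged to triples, and repeated blocks only lower the count, so
    constructions need not exclude either. *)
Lemma C_card_leq (T I : finType) (F : I -> {set T}) :
  3 <= #|T| -> (forall i, #|F i| <= 3) ->
  (forall x y, x != y -> exists i, (x \in F i) && (y \in F i)) ->
  C_card #|T| <= #|I|.
Proof.
move=> T3 F3 Fcov.
have /fin_all_exists2[G G3 FG] : forall i, exists2 t : {set 'I_#|T|},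
    #|t| = 3 & enum_rank @: F i \subset t.
  move=> i; apply: exists_superset3; first by rewrite card_ord.
  by rewrite card_imset //; apply: enum_rank_inj.
pose C : {set {set complete #|T|}} := [set G i | i in I].
apply: leq_trans (C_card_min T3 (_ : triangle_cover C)) (leq_imset_card _ _).
apply/andP; split.
  apply/subsetP => _ /imsetP[i _ ->]; rewrite inE G3 /=.
  by do 2!apply/forall_inP=> ? _; apply/implyP.
apply/forallP => x; apply/forallP => y; apply/implyP => xy.
have /Fcov[i /andP[xi yi]] : enum_val x != enum_val y.
  by rewrite (inj_eq enum_val_inj).
apply/existsP; exists (G i); rewrite imset_f //=.
by apply/andP; split; apply: (subsetP (FG i)); apply/imsetP;
  [exists (enum_val x)|exists (enum_val y)]; rewrite ?enum_valK.
Qed.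

Lemma leq_cards3 (T : finType) (a b c : T) : #|[set a; b; c]| <= 3.
Proof.
by rewrite setUC cardsU1 cards2; case: (_ \notin _); case: (_ != _).
Qed.

(** The old points are grouped in pairs, and each pair forms a triple with the new point [None]. *)
Lemma C_card_succ m : 3 <= m -> C_card m.+1 <= C_card m + uphalf m.
Proof.
move=> m3; have [T cov cT] := C_card_cover m3.
have m_gt0 : 0 < m by lia.
(* An index out of range falls back to 0. This occurs only for m odd, at 2j+1 = m in the last
   triple. *)
pose pt k : option 'I_m := Some (insubd (Ordinal m_gt0) k).
pose F (i : {t | t \in T} + 'I_(uphalf m)) : {set option 'I_m} :=
  match i with
  | inl t => Some @: (val t : {set 'I_m})
  | inr j => [set None; pt j.*2; pt j.*2.+1]
  end.
have -> : C_card m + uphalf m = #|{: {t | t \in T} + 'I_(uphalf m)}|.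
  by rewrite card_sum card_sig card_ord -cT.
have <- : #|{: option 'I_m}| = m.+1 by rewrite card_option card_ord.
have inf (x : 'I_m) : exists i, (None \in F i) && (Some x \in F i).
  have lt : x./2 < uphalf m by have := ltn_ord x; lia.
  exists (inr (Ordinal lt)); rewrite !inE /=.
  have E (k : nat) : k = x -> pt k = Some x by move=> ->; rewrite /pt valKd.
  have [/E->|/E->] : x./2.*2 = x \/ x./2.*2.+1 = x by lia.
    by rewrite eqxx.
  by rewrite eqxx orbT.
apply: (C_card_leq (F := F)); first by rewrite card_option card_ord; lia.
  case=> [t|j] /=; last exact: leq_cards3.
  rewrite card_imset; last exact: Some_inj.
  by rewrite (triangle_cover_card3 cov (valP t)).
move=> [x|] [y|] // xy.
  have [t [tT xt yt]] := triangle_coverP cov (xy : x != y).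
  by exists (inl (Sub t tT)); rewrite /= !imset_f.
by have [i] := inf x; exists i; rewrite andbC.
Qed.

(** * Bose-type coverings *)

Section Bose.
Variables (N : nat) (op : 'I_N -> 'I_N -> 'I_N).
Hypotheses (op_comm : commutative op) (op_inj : forall x, injective (op x)).

(* 'I_N x Z_3 with the blocks {(x,i), (y,i), (op x y, i+1)} for x < y: the pairs
   {(x,i), (op x x, i+1)} are the only ones that may stay uncovered. *)
Definition bose_index : finType :=
  ({p : 'I_N * 'I_N | p.1 < p.2} * 'I_3)%type.

Definition bose_block (k : bose_index) : {set 'I_N * 'I_3} :=
  let: (p, i) := k in
  [set ((val p).1, i); ((val p).2, i); (op (val p).1 (val p).2, ordS i)].

Lemma card_bose_index : #|bose_index| = 'C(N, 2) * 3.
Proof.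
rewrite card_prod card_ord card_sig; congr (_ * 3).
rewrite -sum1_card -(pair_big_dep xpredT (fun i j : 'I_N => i < j)
  (fun _ _ => 1)) /=.
rewrite (exchange_big_dep xpredT) //= -bin2_sum big_mkord.
apply: eq_bigr => j _; rewrite (big_ord_narrow (ltnW (ltn_ord j))).
by rewrite sum_nat_const card_ord muln1.
Qed.

Lemma ordS3_cases (i j : 'I_3) : [\/ i = j, j = ordS i | i = ordS j].
Proof.
by case: i j => [[|[|[|//]]] i] [[|[|[|//]]] j];
  [constructor 1 | constructor 2 | constructor 3 | constructor 3
  | constructor 1 | constructor 2 | constructor 2 | constructor 3
  | constructor 1]; apply: val_inj.
Qed.

Definition bose_leftover (a b : 'I_N * 'I_3) : bool :=
  b == (op a.1 a.1, ordS a.2).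

(** For (x,i) and (z,i+1), surjectivity of [op x] gives z = [op x y]. Unless z = [op x x], y differs
    from x and the block of {x,y} at level i contains both points. *)
Lemma bose_block_cover a b : a != b ->
  [\/ exists k, (a \in bose_block k) && (b \in bose_block k),
      bose_leftover a b | bose_leftover b a].
Proof.
pose cov a b := exists k, (a \in bose_block k) && (b \in bose_block k).
have covC a' b' : cov a' b' -> cov b' a' by case=> k; rewrite andbC; exists k.
have cov_pair x y i : x != y ->
    exists k, [/\ (x, i) \in bose_block k, (y, i) \in bose_block k
                & (op x y, ordS i) \in bose_block k].
  move=> xy; wlog lt_xy : x y xy / x < y.
    move=> IH; have [/IH|lt_yx|/val_inj Exy] := ltngtP x y; first exact.
      have [|k [yk xk]] := IH y x _ lt_yx; first by rewrite eq_sym.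
      by rewrite op_comm; exists k.
    by rewrite Exy eqxx in xy.
  by exists (Sub (x, y) lt_xy, i); rewrite !inE /= !eqxx !orbT.
have cov_succ x z i : z != op x x -> cov (x, i) (z, ordS i).
  have [op' _ opK] := injF_bij (@op_inj x); rewrite -(opK z) => zx.
  have /(cov_pair _ _ i)[k [xk _ zk]] : x != op' z.
    by apply: contraNneq zx => <-.
  by exists k; rewrite xk zk.
case: a b => [x i] [z j]; rewrite /bose_leftover /=.
have [<-|->|->] := ordS3_cases i j; rewrite !xpair_eqE ?eqxx ?andbT => ab.
- have [k [xk zk _]] := cov_pair _ _ i ab.
  by constructor 1; exists k; rewrite xk zk.
- have [_|/cov_succ] := eqVneq z (op x x); [by constructor 2|].
  by move=> /(_ i); constructor 1.
- have [_|/cov_succ] := eqVneq x (op z z); [by constructor 3|].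
  by move=> /(_ j)/covC; constructor 1.
Qed.

(** Common frame of the constructions below: [F] takes care of the leftover pairs and of the points
    outside the image of [emb]. *)
Lemma C_card_bose (T I : finType) (emb : 'I_N * 'I_3 -> T)
    (F : I -> {set T}) :
  3 <= #|T| -> (forall k, #|F k| <= 3) ->
  (forall x i, exists k,
     (emb (x, i) \in F k) && (emb (op x x, ordS i) \in F k)) ->
  (forall s t, s != t -> (exists a b, s = emb a /\ t = emb b) \/
     exists k, (s \in F k) && (t \in F k)) ->
  C_card #|T| <= 'C(N, 2) * 3 + #|I|.
Proof.
move=> T3 F3 diag cov; rewrite -card_bose_index -card_sum.
pose G (k : bose_index + I) : {set T} :=
  match k with inl p => emb @: bose_block p | inr q => F q end.
apply: (C_card_leq (F := G)) => // [[[p i]|q]|s t st] //=.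
  by apply: leq_trans (leq_imset_card _ _) (leq_cards3 _ _ _).
have [[a [b [Ds Dt]]]|[k stk]] := cov s t st; last by exists (inr k).
subst s t; have : a != b by apply: contraNneq st => ->.
case/bose_block_cover => [[k /andP[ak bk]]|/eqP->|/eqP->].
- by exists (inl k); rewrite /= !imset_f.
- by have [k] := diag a.1 a.2; rewrite -surjective_pairing; exists (inr k).
by have [k] := diag b.1 b.2; rewrite -surjective_pairing andbC; exists (inr k).
Qed.

End Bose.

(** * Commutative quasigroups modulo N *)

Definition add_mod N x y := if x + y < N then x + y else x + y - N.

(* A bijection of {0, .., N-1} which inverts doubling mod N for N odd, and sends
   2 x to x for x < N/2 when N is even. *)
Definition half_mod N s := if odd s then s./2 + uphalf N else s./2.

Lemma add_mod_lt N (x y : 'I_N) : add_mod N x y < N.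
Proof. by have := ltn_ord x; have := ltn_ord y; rewrite /add_mod; case: ifP; lia. Qed.

Lemma half_add_mod_lt N (x y : 'I_N) : half_mod N (add_mod N x y) < N.
Proof. by have := add_mod_lt x y; rewrite /half_mod; case: ifP; lia. Qed.

Definition ord_add N (x y : 'I_N) : 'I_N := Ordinal (add_mod_lt x y).
Definition ord_half_add N (x y : 'I_N) : 'I_N := Ordinal (half_add_mod_lt x y).

Lemma ord_add_comm N : commutative (@ord_add N).
Proof. by move=> x y; apply: val_inj; rewrite /= /add_mod addnC. Qed.

Lemma ord_add_inj N x : injective (@ord_add N x).
Proof.
move=> y z /(congr1 val) /= Exyz; apply: val_inj => /=; move: Exyz.
have := ltn_ord x; have := ltn_ord y; have := ltn_ord z.
by rewrite /add_mod; do 2!case: ifP; lia.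
Qed.

Lemma ord_half_add_comm N : commutative (@ord_half_add N).
Proof. by move=> x y; apply: val_inj; rewrite /= /add_mod addnC. Qed.

(** On values below N, [half_mod] is injective: even ones land below [uphalf N], odd ones do not. *)
Lemma ord_half_add_inj N x : injective (@ord_half_add N x).
Proof.
move=> y z /(congr1 val) /= Exyz; apply: (@ord_add_inj N x); apply: val_inj.
move: Exyz => /=; have := add_mod_lt x y; have := add_mod_lt x z.
by rewrite /half_mod; do 2!case: ifP; lia.
Qed.

(** This is idempotence for N odd (Bose) and half-idempotence for N even (Skolem). *)
Lemma val_ord_half_add_diag N (x : 'I_N) :
  ord_half_add x x = (if odd N || (x < N./2) then val x else x - N./2) :> nat.
Proof.
have := ltn_ord x; rewrite /= /half_mod /add_mod.
by do 3!case: ifP; lia.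
Qed.

Lemma bin2_double t : 'C(t.*2, 2) = t * (t.*2).-1.
Proof. by rewrite bin2 -muln2 -mulnA [2 * _]mulnC mulnA muln2 doubleK. Qed.

Lemma bin2_doubleS t : 'C(t.*2.+1, 2) = t.*2.+1 * t.
Proof. by rewrite bin2 /= -muln2 mulnA muln2 doubleK. Qed.

Lemma ord_double_cases t (x : 'I_t.*2) :
  exists y : 'I_t, x = y :> nat \/ x = t + y :> nat.
Proof.
have lt_x := ltn_ord x; have [x_t|x_t] := ltnP x t.
  by exists (Ordinal x_t); left.
have lt : x - t < t by lia.
by exists (Ordinal lt); right; rewrite /= subnKC.
Qed.

(** Modulo 2t the points x and x+t have the same double, so one triple settles two leftover pairs.
    The count is 3t(2t-1) + 3t. *)
Lemma C_card_6t t : 0 < t -> C_card (6 * t) <= 6 * t * t.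
Proof.
move=> t_gt0; have N_gt0 : 0 < t.*2 by lia.
pose pt k : 'I_t.*2 := insubd (Ordinal N_gt0) k.
have ptE (k : nat) (x : 'I_t.*2) : k = x -> pt k = x by move=> ->; apply: valKd.
have pt_val k : k < t.*2 -> pt k = k :> nat by move=> lt; rewrite insubdK.
pose F (k : 'I_t * 'I_3) : {set 'I_t.*2 * 'I_3} :=
  [set (pt k.1, k.2); (pt (t + k.1), k.2); (pt k.1.*2, ordS k.2)].
have := @C_card_bose _ _ (@ord_add_comm t.*2) (@ord_add_inj t.*2) _ _ id F.
rewrite !card_prod !card_ord bin2_double mulnC => H.
have -> : 6 * t = 3 * t.*2 by lia.
apply: leq_trans (H _ _ _ _) _; [lia|by move=> k; apply: leq_cards3| | |nia].
  move=> x i; have lt_x := ltn_ord x; have [y Dx] := ord_double_cases x.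
  exists (y, i); rewrite !inE !xpair_eqE !eqxx !andbT /=.
  have -> : pt y.*2 = ord_add x x.
    by apply: ptE; have := ltn_ord y; rewrite /= /add_mod; case: ifP; lia.
  rewrite eqxx !orbT andbT.
  by case: Dx => Dx; rewrite (ptE _ x (esym Dx)) eqxx ?orbT.
by move=> a b ab; left; exists a, b.
Qed.

Definition column (N : nat) (x : 'I_N) : {set 'I_N * 'I_3} :=
  [set (x, ord0); (x, inord 1); (x, ord_max)].

Lemma in_column N (x : 'I_N) i : (x, i) \in column x.
Proof.
rewrite !inE !xpair_eqE !eqxx /=.
by case: i => [[|[|[|//]]] lt]; rewrite -!val_eqE /= ?inordK ?orbT.
Qed.

(** Columns settle the leftover pairs over x < t. The others join (t+x,i) to (x,i+1); adding the new
    point to each also covers all pairs through it. The count is 3t(2t-1) + t + 3t. *)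
Lemma C_card_6t1 t : 0 < t -> C_card (6 * t).+1 <= t * (6 * t).+1.
Proof.
move=> t_gt0; have N_gt0 : 0 < t.*2 by lia.
pose pt k : 'I_t.*2 := insubd (Ordinal N_gt0) k.
have ptE (k : nat) (x : 'I_t.*2) : k = x -> pt k = x by move=> ->; apply: valKd.
pose F (k : 'I_t + 'I_t * 'I_3) : {set option ('I_t.*2 * 'I_3)} :=
  match k with
  | inl x => Some @: column (pt x)
  | inr (x, i) => [set None; Some (pt (t + x), i); Some (pt x, ordS i)]
  end.
have inf (p : 'I_t.*2 * 'I_3) : exists k, (None \in F k) && (Some p \in F k).
  case: p => x i; have [y [Dx|Dx]] := ord_double_cases x.
    exists (inr (y, ord_pred i)); rewrite !inE /= ord_predK.
    by rewrite (ptE y x) // eqxx ?orbT.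
  by exists (inr (y, i)); rewrite !inE /= (ptE _ x (esym Dx)) eqxx ?orbT.
have := @C_card_bose _ _ (@ord_half_add_comm t.*2) (@ord_half_add_inj t.*2)
  _ _ Some F.
rewrite card_option card_sum !card_prod !card_ord bin2_double mulnC => H.
have -> : 6 * t = 3 * t.*2 by lia.
apply: leq_trans (H _ _ _ _) _; [lia| | | |nia].
- case=> [x|[x i]] /=; last exact: leq_cards3.
  by apply: leq_trans (leq_imset_card _ _) (leq_cards3 _ _ _).
- move=> x i; have [y Dx] := ord_double_cases x.
  have Dxx : pt y = ord_half_add x x.
    apply/ptE/esym/(etrans (val_ord_half_add_diag x)).
    by rewrite odd_double doubleK /=; case: ifP; have := ltn_ord y; lia.
  case: Dx => Dx.
    exists (inl y); rewrite /= -Dxx (ptE y x) //.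
    by rewrite !(imset_f _ (in_column _ _)).
  exists (inr (y, i)); rewrite !inE /= (ptE _ x (esym Dx)) Dxx !eqxx.
  by rewrite ?orbT.
case=> [a|] [b|] // ab; [by left; exists a, b| | ]; right.
  by have [k] := inf a; exists k; rewrite andbC.
exact: inf.
Qed.

(** By idempotence all leftover pairs lie in columns. The count is 3t(2t+1) + (2t+1). *)
Lemma C_card_6t3 t : C_card (6 * t + 3) <= (2 * t).+1 * (3 * t).+1.
Proof.
have := @C_card_bose _ _ (@ord_half_add_comm t.*2.+1)
  (@ord_half_add_inj t.*2.+1) _ _ id (@column t.*2.+1).
rewrite !card_prod !card_ord bin2_doubleS => H.
have -> : 6 * t + 3 = t.*2.+1 * 3 by lia.
apply: leq_trans (H _ _ _ _) _; [lia|by move=> x; apply: leq_cards3| | |nia].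
  move=> x i; have lt_x := ltn_ord x; exists x; rewrite in_column.
  have -> : ord_half_add x x = x.
    by apply/val_inj/(etrans (val_ord_half_add_diag x)); case: ifP; lia.
  exact: in_column.
by move=> a b ab; left; exists a, b.
Qed.

(* The parts are m and m+1, except for m = 4, 5 mod 6, where (m-1, m+2) gives the
   same total and avoids the coverings of K_k with k = 5 mod 6. *)
Lemma C_card_pair_leq m : 2 < m -> exists m1 m2,
  [/\ m1 + m2 = m.*2.+1, 3 <= m1, 3 <= m2
    & 6 * (C_card m1 + C_card m2) < m.*2.+1 * m + (m %% 6 == 4) + 6].
Proof.
move=> m3; have [t Dm] : exists t, m = 6 * t + m %% 6 by exists (m %/ 6); lia.
have : m %% 6 < 6 by lia.
have c2 k := @C_card_succ (6 * k).+1.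
have c4 k := @C_card_succ (6 * k + 3).
move: Dm; case: (m %% 6) => [|[|[|[|[|[|//]]]]]] Dm _.
- exists (6 * t), (6 * t).+1; split; try lia.
  have := @C_card_6t t; have := @C_card_6t1 t; rewrite Dm; nia.
- exists (6 * t).+1, (6 * t).+2; split; try lia.
  have := @C_card_6t1 t; have := c2 t; rewrite Dm; nia.
- exists (6 * t).+2, (6 * t + 3); split; try lia.
  have := C_card_6t3 t; have := @C_card_6t1 t; have := c2 t; rewrite Dm; nia.
- exists (6 * t + 3), (6 * t + 3).+1; split; try lia.
  have := C_card_6t3 t; have := c4 t; rewrite Dm; nia.
- exists (6 * t + 3), (6 * t.+1); split; try lia.
  have := C_card_6t3 t; have := @C_card_6t t.+1; rewrite Dm; nia.
exists (6 * t + 3).+1, (6 * t.+1).+1; split; try lia.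
have := C_card_6t3 t; have := c4 t; have := @C_card_6t1 t.+1; rewrite Dm; nia.
Qed.

Theorem mainTheorem1 (n : nat) (hodd : odd n) (hn : 7 <= n) :
  domination_number (johnson n 3) = phi n.
Proof.
have [m1_m2 phi_le] := phi_min (ltnW hn).
have [m Dn] : exists m, n = m.*2.+1 by exists n./2; lia.
have m3 : 2 < m by lia.
apply/eqP; rewrite eqn_leq; apply/andP; split.
  have [m1 [m2 [<- m13 m23 <-]]] := m1_m2.
  exact: domination_johnson3_leq.
have [[D domD <-] _] := domination_number_min (johnson n 3).
have lower := johnson3_dominating_lower Dn m3 domD.
have [m1 [m2 [Dm m13 m23 upper]]] := C_card_pair_leq m3.
apply: leq_trans (phi_le m1 m2 _ m13 m23) _; first by rewrite Dm.
(* Six times the covering total is less than 6|D| + 6, so integrality closes the gap. *)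
by rewrite -Dn in upper; lia.
Qed.
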